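(* For every integer $n \geq 0$, $$L_n^{(-1)}(x) = \frac{(-1)^n}{n!} \sum_{j=0}^{n} s(n,j)\,(-1)^j \varphi_j(-x)$$ as polynomials in $x$, where $L_n^{(-1)}(x)$ is the Laguerre polynomial of order $-1$, $s(n,j)$ are the (signed) Stirling numbers of the first kind, and $\varphi_j$ are the exponential polynomials.
   Context: The Laguerre polynomials of order $-1$, $L_n^{(-1)}(x)$, $n = 0,1,2,\ldots$, are defined by the generating function $$e^{\frac{-xt}{1-t}} = \sum_{n=0}^{\infty} L_n^{(-1)}(x)\, t^n, \quad |t|<1,$$ or, equivalently, by the Rodrigues formula $L_n^{(-1)}(x) = \frac{x e^x}{n!} \frac{d^n}{dx^n}\left(e^{-x} x^{n-1}\right)$. The numbers $s(n,k)$ are the signed Stirling numbers of the first kind, $y(y-1)\cdots(y-n+1) = \sum_{k=0}^n s(n,k)\, y^k$, and $S(n,k)$ are the Stirling numbers of the second kind, $y^n=\sum_{k=0}^n S(n,k)\,y(y-1)\cdots(y-k+1)$. The exponential polynomials (single-variable Bell polynomials) are $\varphi_m(x) = \sum_{k=0}^{m} S(m,k)\, x^k$, $m=0,1,2,\ldots$ *)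

(* Defs.v *)
From HB Require Import structures.
From mathcomp Require Import all_boot all_order all_algebra.
From mathcomp Require Import all_classical all_reals all_analysis.

Set Implicit Arguments.
Unset Strict Implicit.
Unset Printing Implicit Defensive.

Import Order.TTheory GRing.Theory Num.Theory.
Import numFieldNormedType.Exports.
Local Open Scope classical_set_scope.
Local Open Scope ring_scope.

(** y (y - 1) ... (y - n + 1), as a polynomial in y *)
Definition ffactX (n : nat) : {poly int} :=
  \prod_(i < n) ('X - (i%:R)%:P).

Definition stirling1 (n k : nat) : int := (ffactX n)`_k.

Lemma mulX_ffactX k : 'X * ffactX k = ffactX k.+1 + k%:R *: ffactX k.
Proof.
rewrite /ffactX big_ord_recr /= mulrBr mulrC.
by rewrite [_ * _%:P]mulrC mul_polyC subrK.
Qed.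

Lemma ffactX_expansion n : exists c : {poly int},
  (size c <= n.+1)%N && ('X^n == \sum_(k < n.+1) c`_k *: ffactX k).
Proof.
elim: n => [|n [c /andP[sc /eqP IH]]].
  exists 1; rewrite size_poly1 /= big_ord1 coef1 scale1r.
  by rewrite /ffactX big_ord0 expr0.
exists (c * 'X + c^`() * 'X).
have coefS k : (c * 'X + c^`() * 'X)`_k.+1 = c`_k + c`_k.+1 *+ k.+1.
  by rewrite coefD !coefMX /= coef_deriv.
apply/andP; split.
  apply/leq_sizeP => -[//|k] /= ltnk.
  have /leq_sizeP cz := sc.
  by rewrite coefS !cz ?mul0rn ?addr0 // leqW.
have cn1 : c`_n.+1 = 0 by have /leq_sizeP -> := sc.
rewrite big_ord_recl coefD !coefMX !eqxx addr0 scale0r add0r.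
under [eqbRHS]eq_bigr do rewrite coefS scalerDl.
rewrite big_split /= exprS IH mulr_sumr.
under [eqbLHS]eq_bigr do rewrite -scalerAr mulX_ffactX scalerDr scalerA.
rewrite big_split /= (inj_eq (addrI _)).
rewrite big_ord_recl mulr0 scale0r add0r [eqbRHS]big_ord_recr /=.
rewrite cn1 mul0rn scale0r addr0; apply/eqP.
by apply: eq_bigr => i _; rewrite mulr_natr.
Qed.

(** S(n, k) is the coefficient of y (y - 1) ... (y - k + 1) in the expansion of
    y ^ n; this expansion is unique, so that the choice is immaterial. *)
Definition stirling2 (n k : nat) : int := (xchoose (ffactX_expansion n))`_k.

Lemma stirling2P n : 'X^n = \sum_(k < n.+1) stirling2 n k *: ffactX k.
Proof. by have /andP[_ /eqP] := xchooseP (ffactX_expansion n). Qed.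

Definition exponential_poly (R : nzRingType) (m : nat) : {poly R} :=
  \sum_(k < m.+1) (stirling2 m k)%:~R *: 'X^k.

(** The sequence of polynomials [L] is the sequence of Laguerre polynomials of
    order -1. The identity determines [L], as the coefficients of a power series
    are determined by its sum near 0. *)
Definition laguerreN1 (R : realType) (L : nat -> {poly R}) : Prop :=
  forall x t : R, `|t| < 1 ->
    series (fun n => (L n).[x] * t ^+ n) @ \oo --> expR (- x * t / (1 - t)).

(* Main.v *)
(* With [a_n = L_n(x)], the generating function [G] solves
   [(1 - t)^2 G' = - x G]; comparing coefficients gives the three-term recurrence
   [(n + 2) a_(n+2) = (2 (n + 1) - x) a_(n+1) - n a_n].
   On the other side, let [U] be the linear (umbral) map sending [y^j] to
   [phi_j(- x)], hence [y (y - 1) ... (y - k + 1)] to [(- x)^k]; it satisfies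
   [U(y p(y - 1)) = - x U(p)].  The sum over [j] is [U(t_n)] for
   [t_n = (- y) (- y - 1) ... (- y - n + 1)], and since
   [y t_(n+1)(y - 1) = - t_(n+2) - 2 (n + 1) t_(n+1) - n (n + 1) t_n], the
   polynomials [(- 1)^n / n! U(t_n)] obey the same recurrence. *)

Require Import Defs.
From mathcomp Require Import all_boot all_order all_algebra.
From mathcomp Require Import all_classical all_reals all_analysis.
From mathcomp Require Import ring lra.

Import Order.TTheory GRing.Theory Num.Theory.
Import numFieldNormedType.Exports.
Local Open Scope classical_set_scope.
Local Open Scope ring_scope.

(** * Power series on a disc: termwise differentiation and uniqueness of coefficients *)

Lemma natrM_expr_bounded (R : realFieldType) (s : R) (n : nat) :
  0 <= s -> s < 1 -> n.+1%:R * s ^+ n <= (1 - s)^-1.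
Proof.
move=> s0 s1; rewrite -[leRHS]mul1r ler_pdivlMr ?subr_gt0//.
have sn k : 0 <= s ^+ k <= 1.
  by rewrite exprn_ge0//= exprn_ile1//; exact: ltW.
(* This is [(n + 1) s^n <= 1 + s + ... + s^n] multiplied by [1 - s]. *)
have H : n.+1%:R * s ^+ n <= 1 + n%:R * s ^+ n.+1.
  elim: n => [|n IH]; first by rewrite expr0 mul0r addr0 mulr1.
  have := ler_wpM2l s0 IH; have /andP[u0 u1] := sn n.+1.
  rewrite !exprS -!nat1r in u0 u1 *; set u := s ^+ n in u0 u1 *.
  nra.
have /andP[u0 _] := sn n.+1.
move: H u0; rewrite exprS -nat1r; set u := s ^+ n; lra.
Qed.

Lemma series_shift (V : zmodType) (u : V ^nat) (n : nat) :
  series u n.+1 = u 0%N + series (fun i => u i.+1) n.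
Proof. by rewrite !seriesEord /= big_ord_recl. Qed.

Lemma cvg_series_shift (R : realType) (u : R ^nat) (l : R) :
  series (fun i => u i.+1) @ \oo --> l -> series u @ \oo --> u 0%N + l.
Proof.
move=> ul; rewrite -cvg_shiftS.
have -> : [sequence series u n.+1]_n = (fun n => u 0%N + series (fun i => u i.+1) n).
  by apply/funext => n; exact: series_shift.
by apply: cvgD => //; exact: cvg_cst.
Qed.

Lemma is_cvg_series_shift (R : realType) (u : R ^nat) :
  cvgn (series u) -> cvgn (series (fun i => u i.+1)).
Proof.
move=> /cvg_ex[l ul]; apply: (@cvgP _ _ (l - u 0%N)).
rewrite -cvg_shiftS in ul.
have -> : series (fun i => u i.+1) = (fun n => series u n.+1 - u 0%N).
  by apply/funext => n; rewrite series_shift addrC addKr.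
by apply: cvgB => //; exact: cvg_cst.
Qed.

Lemma is_cvg_pseries_diffs (R : realType) (c : R ^nat) (x z : R) :
  cvgn (pseries c x) -> `|z| < `|x| -> cvgn (pseries (pseries_diffs c) z).
Proof.
move=> Cx zx; pose r := (`|z| + `|x|) / 2.
have zr : `|z| < r by rewrite /r; lra.
have rx : r < `|x| by rewrite /r; lra.
have r0 : 0 < r := le_lt_trans (normr_ge0 _) zr.
have s0 : 0 <= `|z| / r by rewrite divr_ge0// ltW.
have s1 : `|z| / r < 1 by rewrite ltr_pdivrMr// mul1r.
pose M := (1 - `|z| / r)^-1 / r.
have M0 : 0 <= M by rewrite divr_ge0// ?invr_ge0 ?subr_ge0; exact: ltW.
have : cvgn (series (fun i => `|c i.+1| * r ^+ i.+1)).
  apply: (is_cvg_series_shift _ (fun i => `|c i| * r ^+ i)).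
  by apply: (is_cvg_pseries_inside_norm Cx); rewrite gtr0_norm.
move=> /(@is_cvg_seriesZ _ _ M) Cr.
apply: normed_cvg; apply: series_le_cvg Cr => [n|n|n].
- by rewrite normr_ge0.
- by rewrite mulr_ge0// mulr_ge0// exprn_ge0// ltW.
rewrite /= /pseries_diffs !normrM normr_nat normrX.
(* [(n + 1) |z|^n = O(r^n)], which leaves the series of [|c_(n+1)| r^(n+1)] *)
have := natrM_expr_bounded _ _ n s0 s1.
rewrite exprMn exprVn mulrA ler_pdivrMr ?exprn_gt0// => H.
rewrite mulrAC [leRHS](_ : _ = ((1 - `|z| / r)^-1 * r ^+ n) * `|c n.+1|).
  by rewrite /= ler_wpM2r.
rewrite /M; set k := (1 - _)^-1.
change (k / r * (`|c n.+1| * r ^+ n.+1) = k * r ^+ n * `|c n.+1|).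
by rewrite exprS; field; rewrite gt_eqF.
Qed.

(** [pseries_snd_diffs] differentiates the sum termwise, given convergence of the series and of its
    first two derived series at some [K] beyond [t]; uniqueness of the derivative identifies the
    result with [df]. *)
Lemma cvg_pseries_diffs (R : realType) (c : R ^nat) (r : R) (f : R -> R) :
  (forall t, `|t| < r -> pseries c t @ \oo --> f t) ->
  forall t df, `|t| < r -> is_derive t (1 : R) f df ->
    pseries (pseries_diffs c) t @ \oo --> df.
Proof.
move=> cf t df tr fdf.
have Cc u : `|u| < r -> cvgn (pseries c u) by move=> /cf /cvgP.
(* Convergence on the whole open disc passes to the derived series: compare [u] with the midpoint of
   [|u|] and [r]. *)
have Cd d : (forall u, `|u| < r -> cvgn (pseries d u)) ->
    forall u, `|u| < r -> cvgn (pseries (pseries_diffs d) u).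
  move=> Cd u ur; have u0 := normr_ge0 u.
  have vE : `|(`|u| + r) / 2| = (`|u| + r) / 2 by rewrite ger0_norm//; lra.
  by apply: (@is_cvg_pseries_diffs _ _ ((`|u| + r) / 2));
    [apply: Cd|]; rewrite vE; lra.
have Cc1 := Cd _ Cc; have Cc2 := Cd _ Cc1.
have t0 := normr_ge0 t.
pose K := (`|t| + r) / 2.
have KE : `|K| = K by rewrite ger0_norm// /K; lra.
have Kr : `|K| < r by rewrite KE /K; lra.
have tK : `|t| < `|K| by rewrite KE /K; lra.
have D := @pseries_snd_diffs _ c K t (Cc K Kr) (Cc1 K Kr) (Cc2 K Kr) tK.
have D' : is_derive t (1 : R) f (limn (pseries (pseries_diffs c) t)).
  apply: near_eq_is_derive D.
  near=> u; apply: cvg_lim => //; apply: cf.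
  near: u; exact: (cvgr_norm_lt t).
have -> : df = limn (pseries (pseries_diffs c) t).
  by rewrite -(@derive_val _ _ _ _ _ _ _ fdf) (@derive_val _ _ _ _ _ _ _ D').
exact: Cc1.
Unshelve. all: by end_near.
Qed.

Lemma cvg_pseries0 (R : realType) (c : R ^nat) : pseries c 0 @ \oo --> c 0%N.
Proof.
apply: cvg_near_cst; near=> n.
have n0 : (0 < n)%N by near: n; exists 1%N.
rewrite /pseries seriesEnat /= big_ltn// big1_seq ?addr0 ?expr0 ?mulr1// => i.
by rewrite mem_index_iota => /andP[_ /andP[i0 _]]; rewrite expr0n gtn_eqF// mulr0.
Unshelve. all: by end_near.
Qed.

(** The value at 0 is [c 0]; the derived series also sums to 0, so induction gives
    [(n + 1) c_(n+1) = 0]. *)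
Lemma pseries_eq0 (R : realType) (c : R ^nat) (r : R) : 0 < r ->
  (forall t, `|t| < r -> pseries c t @ \oo --> (0 : R)) -> forall n, c n = 0.
Proof.
move=> r0 + n; elim: n c => [|n IH] c c0.
  apply: (cvg_unique _ (cvg_pseries0 _ c)) => //.
  by apply: c0; rewrite normr0.
have : pseries_diffs c n = 0.
  apply: IH => t tr.
  by apply: (cvg_pseries_diffs _ _ r (fun=> 0)) => //; exact: is_derive_cst.
by move/eqP; rewrite /pseries_diffs mulf_eq0 pnatr_eq0/= => /eqP.
Qed.

Lemma cvg_pseries_mulX (R : realType) (c : R ^nat) (t l : R) :
  pseries c t @ \oo --> l ->
  pseries (fun n => if n is m.+1 then c m else 0) t @ \oo --> t * l.
Proof.
move=> cl; set d := fun n => _.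
have := cvg_series_shift _ (fun n => d n * t ^+ n) (t * l).
rewrite [d 0%N * _]mul0r add0r; apply.
rewrite [X in X @ \oo --> _](_ : _ = (fun n => t * pseries c t n)).
  by apply: cvgM => //; exact: cvg_cst.
apply/funext => n; rewrite /pseries /series /= mulr_sumr.
by apply: eq_bigr => i _; rewrite exprS mulrCA.
Qed.

(** * The recurrence from the generating function *)

Lemma is_derive_laguerreN1_gf (R : realType) (x t : R) : `|t| < 1 ->
  is_derive t (1 : R) (fun t => expR (- x * t / (1 - t)))
    (- x / (1 - t) ^+ 2 * expR (- x * t / (1 - t))).
Proof.
move=> t1; have t1' : 1 - t != 0.
  by rewrite subr_eq0; apply: contraTneq t1 => <-; rewrite normr1 ltxx.
have D : is_derive t (1 : R) (fun t => - x * t / (1 - t)) (- x / (1 - t) ^+ 2).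
  have D1 : is_derive t (1 : R) (fun u : R => 1 - u) (- 1).
    by rewrite -[- 1]add0r; apply: is_deriveB.
  have D2 := @is_deriveV R (fun u => 1 - u) t (- 1) 1 t1' D1.
  have D3 : is_derive t (1 : R) (fun u : R => - x * u) (- x).
    have := @is_deriveZ R R R id (- x) t 1 1 (is_derive_id t 1).
    by rewrite /GRing.scale /= mulr1.
  apply: (@is_derive_eq _ _ _ _ _ _ _ _ (@is_deriveM R R _ _ t 1 _ _ D3 D2)).
  by rewrite /GRing.scale /=; field.
by apply: is_derive_eq; rewrite mulrC.
Qed.

Lemma laguerreN1_rec (R : realType) (L : nat -> {poly R}) (x : R) :
  laguerreN1 L ->
  [/\ (L 0%N).[x] = 1, (L 1%N).[x] = - x &
    forall n, n.+2%:R * (L n.+2).[x] =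
      (n.+1%:R *+ 2 - x) * (L n.+1).[x] - n%:R * (L n).[x]].
Proof.
move=> hL; pose a n := (L n).[x].
pose sh (c : R ^nat) n := if n is m.+1 then c m else 0.
pose e t := expR (- x * t / (1 - t)).
have ca t : `|t| < 1 -> pseries a t @ \oo --> e t by exact: hL.
pose b := pseries_diffs a.
have cb t : `|t| < 1 -> pseries b t @ \oo --> - x / (1 - t) ^+ 2 * e t.
  by move=> t1; apply: (cvg_pseries_diffs _ _ 1 e) => //;
    exact: is_derive_laguerreN1_gf.
(* [sh] is multiplication by [t] on coefficients, so these are the coefficients of
   [(1 - t)^2 G' + x G]. *)
have ode n : b n - (sh b n + sh b n) + sh (sh b) n + x * a n = 0.
  move: n; apply: (@pseries_eq0 _ _ 1) => // t t1.
  have t1' : 1 - t != 0.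
    by rewrite subr_eq0; apply: contraTneq t1 => <-; rewrite normr1 ltxx.
  have c0 := ca _ t1; have c1 := cb _ t1.
  have c2 := cvg_pseries_mulX _ _ _ _ c1; have c3 := cvg_pseries_mulX _ _ _ _ c2.
  pose df := - x / (1 - t) ^+ 2 * e t.
  have <- : df - (t * df + t * df) + t * (t * df) + x * e t = 0.
    by rewrite /df; field.
  rewrite [X in X @ _ --> _](_ : _ = (fun m => pseries b t m
      - (pseries (sh b) t m + pseries (sh b) t m) + pseries (sh (sh b)) t m
      + x * pseries a t m)).
    apply: cvgD; last by apply: cvgM => //; exact: cvg_cst.
    by apply: cvgD => //; apply: cvgB => //; apply: cvgD.
  apply/funext => m; rewrite /pseries /series /=.
  rewrite mulr_sumr -big_split -sumrB -!big_split /=.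
  by apply: eq_bigr => i _; ring.
have a0 : a 0%N = 1.
  have := ca 0; rewrite normr0 => /(_ ltr01).
  rewrite /e mulr0 mul0r expR0.
  exact: (cvg_unique _ (cvg_pseries0 _ a)).
have a1 : a 1%N = - x.
  have := ode 0%N; rewrite /b /pseries_diffs /= a0; lra.
split=> // n; have := ode n.+1; rewrite /b /pseries_diffs /= -/(a _) -/(a _) -/(a _).
(* The term [sh (sh b) n.+1] is [n a_n]: the default 0 of [sh] at [n = 0], and [b (n - 1)]
   otherwise. *)
by case: n => [|n] /=; lra.
Qed.

(** * Falling factorials as a basis *)

Lemma monic_ffactX n : ffactX n \is monic.
Proof. by apply: monic_prod => i _; exact: monicXsubC. Qed.

Lemma size_ffactX n : size (ffactX n) = n.+1.
Proof. by rewrite size_prod_XsubC /index_enum -enumT size_enum_ord. Qed.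

(** In the expansion of [y^n] only the term [k = n] reaches degree [n], and [ffactX n] is monic. *)
Lemma stirling2_diag n : stirling2 n n = 1.
Proof.
have := congr1 (coefp n) (stirling2P n); rewrite /coefp coefXn eqxx.
rewrite coef_sum big_ord_recr /= big1 ?add0r => [|i _].
  have := monic_ffactX n; rewrite monicE lead_coefE size_ffactX /= => /eqP.
  by rewrite coefZ => ->; rewrite mulr1.
by rewrite coefZ nth_default ?mulr0// size_ffactX.
Qed.

Lemma ffactX_span (P : {poly int} -> Prop) :
  (forall p q, P p -> P q -> P (p + q)) ->
  (forall c p, P p -> P (c *: p)) ->
  (forall k, P (ffactX k)) -> forall p, P p.
Proof.
move=> PD PZ Pf p.
have P0 : P 0 by rewrite -(scale0r (ffactX 0)); exact: PZ.
rewrite -[p]coefK poly_def; apply: (big_ind P) => // i _; apply: (PZ).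
rewrite stirling2P; apply: (big_ind P) => // j _; exact: PZ.
Qed.

Lemma ffactX_shift n : 'X * (ffactX n \Po ('X - 1)) = ffactX n.+1.
Proof.
rewrite /ffactX big_ord_recl /= subr0; congr (_ * _).
rewrite rmorph_prod; apply: eq_bigr => i _ /=.
by rewrite comp_polyB comp_polyX comp_polyC /bump /= natrD polyCD opprD addrA polyC1.
Qed.

(** * The umbral map *)

Section Umbral.
Variable R : comNzRingType.

Definition umbral (p : {poly int}) : {poly R} :=
  \sum_(j < size p) (p`_j)%:~R *: (exponential_poly R j \Po (- 'X)).

(** Additivity needs a range of summation common to both polynomials. *)
Lemma umbralE n (p : {poly int}) : (size p <= n)%N ->
  umbral p = \sum_(j < n) (p`_j)%:~R *: (exponential_poly R j \Po (- 'X)).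
Proof.
move=> pn; rewrite /umbral.
rewrite (big_ord_widen _
  (fun j => (p`_j)%:~R *: (exponential_poly R j \Po (- 'X))) pn).
rewrite big_mkcond /=; apply: eq_bigr => i _.
by case: ltnP => // ip; rewrite nth_default// scale0r.
Qed.

Lemma umbralD p q : umbral (p + q) = umbral p + umbral q.
Proof.
pose n := maxn (size p) (size q).
rewrite !(@umbralE n) ?leq_maxl ?leq_maxr ?size_polyD//.
by rewrite -big_split; apply: eq_bigr => i _; rewrite coefD intrD scalerDl.
Qed.

Lemma umbralZ c p : umbral (c *: p) = c%:~R *: umbral p.
Proof.
rewrite !(@umbralE (size p)) ?size_scale_leq// scaler_sumr.
by apply: eq_bigr => i _; rewrite coefZ intrM scalerA.
Qed.

Lemma umbral_sum n (F : 'I_n -> {poly int}) :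
  umbral (\sum_(i < n) F i) = \sum_(i < n) umbral (F i).
Proof.
apply: (big_morph umbral umbralD).
by rewrite /umbral size_poly0 big_ord0.
Qed.

Lemma umbralXn n : umbral 'X^n = exponential_poly R n \Po (- 'X).
Proof.
rewrite (@umbralE n.+1) ?size_polyXn// big_ord_recr /= big1 => [|i _].
  by rewrite coefXn eqxx scale1r add0r.
by rewrite coefXn ltn_eqF// scale0r.
Qed.

(** Apply [umbral] to the expansion of [y^n]: by strong induction the terms [k < n] cancel those of
    [phi_n(- x)], and [S(n, n) = 1] isolates the last one. *)
Lemma umbral_ffactX n : umbral (ffactX n) = (- 'X) ^+ n.
Proof.
elim/ltn_ind: n => n IH.
have := congr1 umbral (stirling2P n).
rewrite umbralXn umbral_sum /exponential_poly.
rewrite raddf_sum /= !big_ord_recr /= stirling2_diag !umbralZ.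
rewrite comp_polyZ comp_Xn_poly !scale1r.
rewrite [X in X + _ = _](eq_bigr
  (fun i : 'I_n => umbral (stirling2 n i *: ffactX i))).
  by move/addrI.
by move=> i _; rewrite umbralZ IH// comp_polyZ comp_Xn_poly.
Qed.

(** By linearity it suffices to take [p = ffactX k], which the left-hand operation raises to
    [ffactX k.+1]. *)
Lemma umbral_shift p : umbral ('X * (p \Po ('X - 1))) = - 'X * umbral p.
Proof.
elim/ffactX_span: p => [p q IHp IHq|c p IH|k].
- by rewrite comp_polyD mulrDr !umbralD IHp IHq mulrDr.
- by rewrite comp_polyZ -scalerAr !umbralZ IH scalerAr.
- by rewrite ffactX_shift !umbral_ffactX exprS.
Qed.

Lemma umbral_ffactXN_rec n :
  umbral (ffactX n.+2 \Po - 'X) =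
    'X * umbral (ffactX n.+1 \Po - 'X)
    - n.+1.*2%:R *: umbral (ffactX n.+1 \Po - 'X)
    - (n * n.+1)%:R *: umbral (ffactX n \Po - 'X).
Proof.
set t := fun n => ffactX n \Po - 'X : {poly int}.
have tS m : t m.+1 = - ('X + m%:R) * t m.
  rewrite /t /ffactX big_ord_recr /= comp_polyM mulrC comp_polyB comp_polyX.
  by rewrite comp_polyC polyC_natr opprD.
(* In [t_(n+1)(y - 1)] the first factor is [1 - y] and the others form [t_n]. *)
have tsh : 'X * (t n.+1 \Po ('X - 1)) = - 'X * ('X - 1) * t n.
  rewrite /t -comp_polyA raddfN /= comp_polyX.
  rewrite {1}/ffactX big_ord_recl /= subr0 comp_polyM comp_polyX mulrA
    mulrN -mulNr; congr (_ * _); rewrite !rmorph_prod; apply: eq_bigr => i _ /=.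
  by rewrite !comp_polyB !comp_polyX !comp_polyC /bump /= natrD polyCD polyC1; ring.
(* With [t_n] factored out: [(y + n + 1)(y + n) = y (y - 1) + 2 (n + 1)(y + n) - n (n + 1)]. *)
have E : t n.+2 = (-1) *: ('X * (t n.+1 \Po ('X - 1))) +
   ((- (n.+1.*2%:R)) *: t n.+1 + (- (n * n.+1)%:R) *: t n).
  rewrite tsh !tS -!mul_polyC !rmorphN /= !polyC_natr -muln2 !natrM; ring.
rewrite -!/(t _) E !umbralD !umbralZ umbral_shift.
rewrite !rmorphN /= !rmorph_nat rmorph1 !scaleNr scale1r.
by rewrite mulNr opprK addrA.
Qed.

Lemma umbral_compN p : umbral (p \Po - 'X) =
  \sum_(j < size p)
    ((p`_j)%:~R * (-1) ^+ j) *: (exponential_poly R j \Po (- 'X)).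
Proof.
rewrite comp_polyE umbral_sum; apply: eq_bigr => j _.
have -> : (- 'X) ^+ j = (-1) ^+ j *: 'X^j :> {poly int}.
  by rewrite -[- 'X]scaleN1r exprZn.
by rewrite scalerA umbralZ umbralXn intrM rmorphXn rmorphN1.
Qed.

End Umbral.

(** * Comparison of the two recurrences *)

Lemma poly_horner_inj (R : numDomainType) (p q : {poly R}) :
  (forall x, p.[x] = q.[x]) -> p = q.
Proof.
move=> pq; apply/eqP; rewrite -subr_eq0; apply: contraT => pq0.
(* The size exceeds the degree by one, so these distinct roots are one too many. *)
have := max_poly_roots (rs := [seq i%:R | i <- iota 0 (size (p - q))]) pq0.
rewrite size_map size_iota ltnn; apply.
  by apply/allP => x _; rewrite rootE hornerD hornerN pq subrr.
by rewrite map_inj_uniq ?iota_uniq// => i j /eqP; rewrite eqr_nat => /eqP.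
Qed.

Theorem mainTheorem5 (R : realType) (L : nat -> {poly R})
    (hL : laguerreN1 L) (n : nat) :
  L n = ((-1) ^+ n / n`!%:R) *:
    \sum_(j < n.+1)
      ((stirling1 n j)%:~R * (-1) ^+ j) *: (exponential_poly R j \Po (- 'X)).
Proof.
pose d m := umbral R (ffactX m \Po - 'X).
have dE m : d m = \sum_(j < m.+1)
    ((stirling1 m j)%:~R * (-1) ^+ j) *: (exponential_poly R j \Po (- 'X)).
  by rewrite /d umbral_compN size_ffactX.
have f0 : ffactX 0 = 1 by rewrite /ffactX big_ord0.
have f1 : ffactX 1 = 'X by rewrite /ffactX big_ord1 subr0.
have d0 : d 0%N = 1.
  rewrite /d; have -> : ffactX 0 \Po - 'X = ffactX 0 by rewrite f0 comp_polyC.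
  by rewrite umbral_ffactX expr0.
have d1 : d 1%N = 'X.
  rewrite /d f1 comp_polyX -scaleN1r -f1 umbralZ umbral_ffactX expr1.
  by rewrite rmorphN1 scaleN1r opprK.
rewrite -dE; apply: poly_horner_inj => x; rewrite hornerZ.
have [a0 a1 arec] := laguerreN1_rec _ _ x hL.
elim/ltn_ind: n => -[|[|n]] IH.
- by rewrite a0 d0 hornerC expr0 fact0 divr1 mulr1.
- by rewrite a1 d1 hornerX expr1 divr1 mulN1r.
have n2 : n.+2%:R != 0 :> R by rewrite pnatr_eq0.
have n1 : n.+1%:R != 0 :> R by rewrite pnatr_eq0.
have nf : n`!%:R != 0 :> R by rewrite pnatr_eq0 -lt0n fact_gt0.
(* The factor [(- 1)^n / n!] turns the recurrence of [d] into that of [L]. *)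
apply: (mulfI n2); rewrite arec !IH//.
rewrite {3}/d umbral_ffactXN_rec -!/(d _) !(hornerD, hornerN, hornerZ, hornerM) hornerX.
rewrite !factS -muln2 !natrM !exprS; field.
by rewrite nf nat1r n1 -natrD add2n n2.
Qed.
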